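(* Let $n,N,l$ be positive integers, let $A_1,\ldots,A_N,B_1,\ldots,B_N\in\mathbb{R}^{n\times n}$ be (entrywise) nonnegative matrices, let $f:\mathbb{R}^n\to\mathbb{R}^n$ be an admissible diagonal nonlinearity with components $f_1,\ldots,f_n$, and let $u(k)\in\mathbb{R}^n$, $k\ge 0$, be a bounded input. Let $f_i(x_i)\to-\infty$ as $x_i\to-\infty$ and $f_i(x_i)\to+\infty$ as $x_i\to+\infty$, $i=1,\ldots,n$. Assume that there exist numbers $\mu>0$, $\lambda>0$ and vectors $d\gg 0$, $\theta\gg 0$ in $\mathbb{R}^n$ such that $$(A_s+B_r)^Td\le\mu d,\qquad s,r=1,\ldots,N,$$ $$(A_s+B_s)\theta\le\lambda\theta,\qquad s=1,\ldots,N,$$ $$\lambda\mu<1.$$ Then there exists a common Lyapunov--Krasovskii functional of the form $$V(x^{(k)})=x^T(k)Px(k)+f^T(x(k-1))Q_1f(x(k-1))+\ldots+f^T(x(k-l))Q_lf(x(k-l)),$$ with $P,Q_1,\ldots,Q_l$ positive definite diagonal matrices, for the family of subsystems $$x(k+1)=A_sf(x(k))+B_sf(x(k-l))+u(k),\qquad s=1,\ldots,N,$$ guaranteeing uniform ultimate boundedness of the switched system $$x(k+1)=A_{\sigma(k)}f(x(k))+B_{\sigma(k)}f(x(k-l))+u(k).$$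
   Context: Vector inequalities are componentwise: $v\le w$ means $v_i\le w_i$ for all $i$, and $v\gg 0$ means $v_i>0$ for all $i$. $\|\cdot\|$ is the Euclidean norm. An admissible diagonal nonlinearity is a continuous map $f:\mathbb{R}^n\to\mathbb{R}^n$ of the form $f(x)=(f_1(x_1),\ldots,f_n(x_n))^T$ such that for each $i$: $x_if_i(x_i)>0$ for all $x_i\ne 0$, and $|f_i(x_i)|\le|x_i|$ for all $x_i$. The integer $l$ is the delay. The switching signal $\sigma$ maps the nonnegative integers to $\{1,\ldots,N\}$. Write $x^{(k)}=(x^T(k),x^T(k-1),\ldots,x^T(k-l))^T\in\mathbb{R}^{(l+1)n}$, and let $x(k,x^{(k_0)},k_0)$ denote the solution of the switched system with initial conditions $k_0\ge 0$, $x^{(k_0)}\in\mathbb{R}^{(l+1)n}$. The switched system is uniformly ultimately bounded with the ultimate bound $R$ if, for any $D>0$, there exists a positive integer $\tilde k$ such that $\|x(k,x^{(k_0)},k_0)\|\le R$ for all $k_0\ge 0$, $\|x^{(k_0)}\|\le D$, $k\ge\tilde k+k_0$ and for arbitrary switching law $\sigma$. *)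

(* Defs.v *)
From HB Require Import structures.
From mathcomp Require Import all_boot all_order all_algebra.
From mathcomp Require Import all_classical all_reals all_analysis.
Import Order.TTheory GRing.Theory Num.Theory.
Import numFieldNormedType.Exports.

Set Implicit Arguments.
Unset Strict Implicit.
Unset Printing Implicit Defensive.

Local Open Scope classical_set_scope.
Local Open Scope ring_scope.

(* The norm that the library puts on matrices is the sup norm, hence this one. *)
Definition enorm (R : realType) (m : nat) (v : 'cV[R]_m) : R :=
  Num.sqrt (\sum_(i < m) v i 0 ^+ 2).

Definition vle (R : realType) (m : nat) (v w : 'cV[R]_m) : Prop :=
  forall i, v i 0 <= w i 0.

Definition vpos (R : realType) (m : nat) (v : 'cV[R]_m) : Prop :=
  forall i, 0 < v i 0.

Definition nonneg_mx (R : realType) (m p : nat) (M : 'M[R]_(m, p)) : Prop :=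
  forall i j, 0 <= M i j.

Definition qform (R : realType) (m : nat) (M : 'M[R]_m) (v : 'cV[R]_m) : R :=
  (v^T *m M *m v) 0 0.

Definition posdef_diag_mx (R : realType) (m : nat) (M : 'M[R]_m) : Prop :=
  is_diag_mx M /\ forall v : 'cV[R]_m, v != 0 -> 0 < qform M v.

Definition admissible (R : realType) (n : nat)
    (f : 'cV[R]_n -> 'cV[R]_n) (fc : 'I_n -> R -> R) : Prop :=
  [/\ continuous f,
      forall (x : 'cV[R]_n) i, f x i 0 = fc i (x i 0),
      forall i (t : R), t != 0 -> 0 < t * fc i t
    & forall i (t : R), `|fc i t| <= `|t| ].

Definition bounded_input (R : realType) (n : nat) (u : nat -> 'cV[R]_n) : Prop :=
  exists M : R, forall k, enorm (u k) <= M.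

(* The space R^((l+1)n) of stacked columns (x(k), x(k-1), ..., x(k-l)). *)
Notation "''Seg[' R ]_ ( n , l )" := ('cV[R]_(\sum_(j < l.+1) n))
  (at level 8, R at level 200, n at level 50, l at level 50,
   format "''Seg[' R ]_ ( n ,  l )") : type_scope.

Definition blk (R : realType) (n l : nat) (X : 'Seg[R]_(n, l)) (j : 'I_l.+1) :
    'cV[R]_n :=
  @submxcol R l.+1 (fun=> n) 1 X j.

(* Trajectories are indexed by int since initial data given at time k0 reach
   back to time k0 - l, which may be negative. *)
Definition segment (R : realType) (n l : nat) (x : int -> 'cV[R]_n) (k : int) :
    'Seg[R]_(n, l) :=
  \mxcol_(j < l.+1) x (k - (j : nat)%:Z).

(* A trajectory is constrained only from time k0 on, so that its segment at k0
   is an arbitrary initial condition. *)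
Definition is_solution (R : realType) (n N l : nat)
    (A B : 'I_N -> 'M[R]_n) (f : 'cV[R]_n -> 'cV[R]_n) (u : nat -> 'cV[R]_n)
    (sigma : nat -> 'I_N) (k0 : nat) (x : int -> 'cV[R]_n) : Prop :=
  forall k : nat, (k0 <= k)%N ->
    x (k%:Z + 1) = A (sigma k) *m f (x k%:Z)
                 + B (sigma k) *m f (x (k%:Z - l%:Z)) + u k.

Definition uniformly_ultimately_bounded (R : realType) (n N l : nat)
    (A B : 'I_N -> 'M[R]_n) (f : 'cV[R]_n -> 'cV[R]_n) (u : nat -> 'cV[R]_n)
    (Rb : R) : Prop :=
  forall D : R, 0 < D ->
  exists2 kt : nat, (0 < kt)%N &
    forall (sigma : nat -> 'I_N) (k0 : nat) (x : int -> 'cV[R]_n),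
      is_solution l A B f u sigma k0 x -> enorm (segment l x k0%:Z) <= D ->
      forall k : nat, (kt + k0 <= k)%N -> enorm (x k%:Z) <= Rb.

(* The block of index lift ord0 j is x(k - (j+1)); Q j stands for Q_(j+1). *)
Definition LK_functional (R : realType) (n l : nat) (f : 'cV[R]_n -> 'cV[R]_n)
    (P : 'M[R]_n) (Q : 'I_l -> 'M[R]_n) (X : 'Seg[R]_(n, l)) : R :=
  qform P (blk X ord0) + \sum_(j < l) qform (Q j) (f (blk X (lift ord0 j))).

(* Because the input does not vanish, V can decrease only outside a ball; the
   uniform rate gamma makes this a sufficient condition for uniform ultimate
   boundedness. A constant switching signal selects a single subsystem. *)
Definition common_LK_functional (R : realType) (n N l : nat)
    (A B : 'I_N -> 'M[R]_n) (f : 'cV[R]_n -> 'cV[R]_n) (u : nat -> 'cV[R]_n)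
    (V : 'Seg[R]_(n, l) -> R) : Prop :=
  [/\ continuous V,
      V 0 = 0 /\ (forall X, X != 0 -> 0 < V X),
      forall M : R, exists r : R, forall X, r <= enorm X -> M <= V X
    & exists r gamma : R, [/\ 0 < r, 0 < gamma &
        forall (s : 'I_N) (k0 : nat) (x : int -> 'cV[R]_n),
          is_solution l A B f u (fun=> s) k0 x ->
          forall k : nat, (k0 <= k)%N -> r <= enorm (segment l x k%:Z) ->
          V (segment l x (k%:Z + 1)) - V (segment l x k%:Z) <= - gamma] ].

(* Main.v *)
Require Import Defs.
From mathcomp Require Import all_boot all_order all_algebra.
From mathcomp Require Import all_classical all_reals all_analysis.
From mathcomp Require Import ring lra.
Import Order.TTheory GRing.Theory Num.Theory.
Import numFieldNormedType.Exports.
Local Open Scope classical_set_scope.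
Local Open Scope ring_scope.

Set Implicit Arguments.
Unset Strict Implicit.
Unset Printing Implicit Defensive.

(** Take P = diag (d_i / theta_i), so that d is what theta becomes under P.
    The two vectors are the two weights of a Schur test: the row bound
    (A_s + B_s) theta <= lambda theta and Cauchy-Schwarz turn the quadratic
    form P at A_s y + B_s z into lambda times a diagonal form in y and z with
    coefficients (A_s^T d)_i / theta_i and (B_s^T d)_i / theta_i.

    The z part, z = f(x(k-l)), has to be paid by Q_l, whatever the active
    subsystem is, so Q_l must dominate lambda beta_i / theta_i with
    beta = max_r B_r^T d. As the sum telescopes along the delay line, this
    same amount is charged to y = f(x(k)), where the total coefficient is at most
    lambda (A_s^T d + beta)_i / theta_i <= lambda mu d_i / theta_i. The
    hypothesis on A_s + B_r for independent s and r is what allows the maximum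
    over r here. Since lambda mu < 1 and |f_i(t)| <= |t|, the term
    - x(k)^T P x(k) absorbs this with room to spare. The spare room is spent
    twice: on a factor 1 + eta that separates the bounded input by Young's
    inequality, and on a strict decrease Q_j - Q_(j+1) = eps I, which leaves

      V(x^(k+1)) - V(x^(k)) <= C - eps W(x^(k)),
      W = sum of the squares f_i(x_i(k-j))^2 over 0 <= j <= l and all i.

    This is [exists_LK_descent]; it holds at each step for each subsystem, hence
    under arbitrary switching. Because every f_i is unbounded in both
    directions, W is coercive ([image_energy_coercive]), so V loses at least 1
    at each step spent outside some ball. Moreover eps W <= V <= c |X|^2: the
    lower bound gives definiteness and radial unboundedness of V, and the upper
    bound makes V bounded on that ball. Then V is eventually trapped below a
    level independent of the initial data ([eventually_trapped]), and
    coercivity of W turns this level into the ultimate bound. *)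

(** * A weighted Schur test *)

(** Cauchy-Schwarz with weights, the total weight being replaced by a positive
    upper bound [L]: then no case is needed for a vanishing row [m], and the
    claim is the positivity of one sum of squares. *)
Lemma sqr_sum_le (R : realFieldType) (I : finType) (m y th : I -> R) (L : R) :
    (forall j, 0 <= m j) -> (forall j, 0 < th j) -> 0 < L ->
    \sum_j m j * th j <= L ->
  (\sum_j m j * y j) ^+ 2 <= L * \sum_j m j / th j * y j ^+ 2.
Proof.
move=> m_ge0 th_gt0 L_gt0 mth_le.
set T := \sum_j m j * y j; set E := \sum_j m j / th j * y j ^+ 2.
set S := \sum_j m j * th j in mth_le.
(* The choice of c that minimises E - 2 c T + c^2 L. *)
pose c := T / L.
have : 0 <= \sum_j m j / th j * (y j - c * th j) ^+ 2.
  by apply: sumr_ge0 => j _; rewrite mulr_ge0 ?sqr_ge0 // divr_ge0 // ltW.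
have -> : \sum_j m j / th j * (y j - c * th j) ^+ 2
    = E - 2 * c * T + c ^+ 2 * S.
  rewrite /E /T /S !mulr_sumr.
  rewrite -sumrN -!big_split /=; apply: eq_bigr => j _.
  by field; rewrite gt_eqF.
move=> sum_ge0.
have S_le : c ^+ 2 * S <= c ^+ 2 * L by rewrite ler_wpM2l ?sqr_ge0.
rewrite -subr_ge0.
have -> : L * E - T ^+ 2 = L * (E - 2 * c * T + c ^+ 2 * L).
  by rewrite /c; field; rewrite gt_eqF.
by rewrite mulr_ge0 ?(ltW L_gt0) // (le_trans sum_ge0) // lerD2l.
Qed.

(** Each row is bounded by Cauchy-Schwarz with weights [th']; the factor
    [th i 0] so produced cancels the denominator on the left, and summing over
    rows leaves the columns weighted by [d]. *)
Lemma schur_test (R : realType) (n m : nat) (M : 'M[R]_(n, m))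
    (d th : 'cV[R]_n) (th' w : 'cV[R]_m) (lambda : R) :
    nonneg_mx M -> vpos d -> vpos th -> vpos th' -> 0 < lambda ->
    vle (M *m th') (lambda *: th) ->
  \sum_i d i 0 / th i 0 * (M *m w) i 0 ^+ 2
    <= lambda * \sum_j (M^T *m d) j 0 / th' j 0 * w j 0 ^+ 2.
Proof.
move=> M_ge0 d_gt0 th_gt0 th'_gt0 lambda_gt0 hM.
apply: (@le_trans _ _ (\sum_i d i 0 / th i 0 *
    (lambda * th i 0 * \sum_j M i j / th' j 0 * w j 0 ^+ 2))).
  apply: ler_sum => i _; rewrite ler_wpM2l ?divr_ge0 ?(ltW (d_gt0 i)) ?(ltW (th_gt0 i)) //.
  rewrite mxE; apply: sqr_sum_le => //.
    by rewrite mulr_gt0 ?th_gt0.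
  by have := hM i; rewrite !mxE.
rewrite le_eqVlt; apply/orP; left; apply/eqP.
under eq_bigr do rewrite mulrA mulr_sumr.
rewrite exchange_big /= mulr_sumr; apply: eq_bigr => j _.
rewrite mxE !mulr_suml mulr_sumr; apply: eq_bigr => i _; rewrite mxE.
by field; rewrite !gt_eqF ?th_gt0 ?th'_gt0.
Qed.

(** The Schur test for the block row (A B) at the stacked vector (y, z), with
    the input [v] split off by Young's inequality. *)
Lemma forced_energy_le (R : realType) (n : nat) (A B : 'M[R]_n)
    (d th y z v : 'cV[R]_n) (lambda eta : R) :
    nonneg_mx A -> nonneg_mx B -> vpos d -> vpos th ->
    0 < lambda -> 0 < eta -> vle ((A + B) *m th) (lambda *: th) ->
  \sum_i d i 0 / th i 0 * (A *m y + B *m z + v) i 0 ^+ 2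
    <= (1 + eta) * lambda * \sum_i ((A^T *m d) i 0 / th i 0 * y i 0 ^+ 2
                                  + (B^T *m d) i 0 / th i 0 * z i 0 ^+ 2)
       + (1 + eta^-1) * \sum_i d i 0 / th i 0 * v i 0 ^+ 2.
Proof.
move=> A_ge0 B_ge0 d_gt0 th_gt0 lambda_gt0 eta_gt0 hAB.
have schur : \sum_i d i 0 / th i 0 * (A *m y + B *m z) i 0 ^+ 2
    <= lambda * \sum_i ((A^T *m d) i 0 / th i 0 * y i 0 ^+ 2
                      + (B^T *m d) i 0 / th i 0 * z i 0 ^+ 2).
  have M_ge0 : nonneg_mx (row_mx A B).
    by move=> i j; rewrite mxE; case: splitP => k _; [exact: A_ge0|exact: B_ge0].
  have th2_gt0 : vpos (col_mx th th).
    by move=> i; rewrite mxE; case: splitP => k _; exact: th_gt0.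
  have hM : vle (row_mx A B *m col_mx th th) (lambda *: th).
    by rewrite mul_row_col -mulmxDl.
  have := @schur_test R n (n + n) (row_mx A B) d th _ (col_mx y z) lambda
    M_ge0 d_gt0 th_gt0 th2_gt0 lambda_gt0 hM.
  rewrite mul_row_col big_split_ord /= tr_row_mx mul_col_mx big_split /=.
  under [X in _ * (X + _)]eq_bigr do rewrite !col_mxEu.
  by under [X in _ * (_ + X)]eq_bigr do rewrite !col_mxEd.
rewrite -mulrA; apply: (@le_trans _ _ ((1 + eta) *
    (\sum_i d i 0 / th i 0 * (A *m y + B *m z) i 0 ^+ 2)
    + (1 + eta^-1) * \sum_i d i 0 / th i 0 * v i 0 ^+ 2)); last first.
  by rewrite lerD2r ler_pM2l //; lra.
rewrite !mulr_sumr -big_split /=; apply: ler_sum => i _.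
set a := (A *m y + B *m z) i 0; set b := v i 0.
have -> : (A *m y + B *m z + v) i 0 = a + b by rewrite mxE.
have p_ge0 : 0 <= d i 0 / th i 0 by rewrite divr_ge0 ?ltW.
rewrite (mulrCA (1 + eta)) (mulrCA (1 + eta^-1)) -mulrDr ler_wpM2l //.
rewrite -subr_ge0.
have -> : (1 + eta) * a ^+ 2 + (1 + eta^-1) * b ^+ 2 - (a + b) ^+ 2
  = eta * (a - b / eta) ^+ 2 by field; rewrite gt_eqF.
by rewrite mulr_ge0 ?sqr_ge0 // ltW.
Qed.

(** * Two facts about sequences *)

(** Summation by parts along the delay line: a constant weight telescopes, and a
    weight that decreases by [e] at each delay yields -[e] times the whole
    sum. *)
Lemma delay_weights_sum (R : comPzRingType) (l : nat) (b e : R) (G : nat -> R) :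
  \sum_(j < l) (b + e * (l - j)%:R) * (G j - G j.+1)
    = b * (G 0%N - G l) + e * (l.+1%:R * G 0%N - \sum_(j < l.+1) G j).
Proof.
elim: l G => [|l IHl] G; first by rewrite big_ord0 big_ord1; ring.
rewrite big_ord_recl [\sum_(j < l.+2) _]big_ord_recl /=.
under eq_bigr do rewrite subSS.
rewrite (IHl (fun j => G j.+1)) subn0.
rewrite -[l.+2%:R]natr1.
under [X in _ = _ + _ * (_ - (_ + X))]eq_bigr do rewrite /bump /= add1n.
ring.
Qed.

(** Above [S] the sequence loses 1 at each step, so it gets below [S] in at most
    [m] steps; from below [S] one step reaches at most [S + C], and anything
    between is decreasing again. *)
Lemma eventually_trapped (R : realType) (v : nat -> R) (S C : R) (m : nat) :
    0 <= C -> (forall k, v k.+1 <= v k + C) ->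
    (forall k, S < v k -> v k.+1 <= v k - 1) -> v 0%N <= S + m%:R ->
  forall k, (m <= k)%N -> v k <= S + C.
Proof.
move=> C_ge0 v_step v_dec v0_le.
(* Either the level S has already been visited, or v has decreased so far. *)
have inv k : v k <= S + C \/ v k <= S + m%:R - k%:R.
  elim: k => [|k IHk]; first by right; rewrite subr0.
  have [vS|/v_dec vS] := leP (v k) S; first by left; have := v_step k; lra.
  by case: IHk => IHk; [left|right; rewrite -natr1]; lra.
move=> k mk; case: (inv k) => // vk.
have : m%:R <= k%:R :> R by rewrite ler_nat.
lra.
Qed.

(** * Diagonal forms and stacked columns *)

Lemma qform_diag (R : realType) (m : nat) (w : 'rV[R]_m) (v : 'cV[R]_m) :
  qform (diag_mx w) v = \sum_i w 0 i * v i 0 ^+ 2.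
Proof.
rewrite /qform -mulmxA mul_diag_mx mxE; apply: eq_bigr => i _.
by rewrite !mxE; ring.
Qed.

Lemma diag_mx_posdef (R : realType) (m : nat) (w : 'rV[R]_m) :
  (forall i, 0 < w 0 i) -> posdef_diag_mx (diag_mx w).
Proof.
move=> w_gt0; split=> [|v v_neq0]; first exact: diag_mx_is_diag.
rewrite qform_diag.
have [i vi_neq0] : exists i, v i 0 != 0.
  apply/existsP; apply: contraNT v_neq0; rewrite negb_exists => /forallP v0.
  by apply/eqP/colP => i; rewrite mxE; apply/eqP; rewrite -[_ == _]negbK.
rewrite (bigD1 i) //= ltr_pwDl //.
  by rewrite mulr_gt0 // exprn_even_gt0.
by apply: sumr_ge0 => j _; rewrite mulr_ge0 ?sqr_ge0 // ltW.
Qed.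

Lemma blk_segment (R : realType) (n l : nat) (x : int -> 'cV[R]_n) (k : int)
    (j : 'I_l.+1) :
  blk (segment l x k) j = x (k - (j : nat)%:Z).
Proof. exact: mxcolK. Qed.

Lemma enorm_ge0 (R : realType) (m : nat) (v : 'cV[R]_m) : 0 <= enorm v.
Proof. exact: sqrtr_ge0. Qed.

Lemma sqr_enorm (R : realType) (m : nat) (v : 'cV[R]_m) :
  enorm v ^+ 2 = \sum_i v i 0 ^+ 2.
Proof. by rewrite sqr_sqrtr // sumr_ge0 // => i _; rewrite sqr_ge0. Qed.

Lemma sqr_enorm_blk (R : realType) (n l : nat) (X : 'Seg[R]_(n, l)) :
  enorm X ^+ 2 = \sum_j \sum_i blk X j i 0 ^+ 2.
Proof.
rewrite sqr_enorm sig_big_dep /= (reindex _ tagnat.rank_bij_on) /=.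
by apply: eq_bigr => p _; rewrite tagnat.rankE !mxE.
Qed.

Lemma enorm_le (R : realType) (m p : nat) (v : 'cV[R]_m) (w : 'cV[R]_p) :
  enorm v ^+ 2 <= enorm w ^+ 2 -> enorm v <= enorm w.
Proof. by rewrite ler_sqr ?nnegrE ?enorm_ge0. Qed.

Lemma blk_continuous (R : realType) (n l : nat) (j : 'I_l.+1) :
  continuous (fun X : 'Seg[R]_(n, l) => blk X j).
Proof.
move=> X Y /= /nbhs_ballP[e e0 es]; apply/nbhs_ballP; exists e => //= Z [_ XZ].
by apply: es; split=> // i k; rewrite !mxE; exact: XZ.
Qed.

Lemma qform_continuous (R : realType) (m : nat) (w : 'rV[R]_m) :
  continuous (qform (diag_mx w)).
Proof.
have -> : qform (diag_mx w) = (fun v => \sum_i w 0 i * v i 0 ^+ 2).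
  by apply/funext => v; rewrite qform_diag.
move=> v; apply: cvg_big => [||i _]; [exact: add_continuous|exact: nbhs_filter|].
have vi_cvg : (fun u : 'cV[R]_m => u i 0) @ v --> v i 0.
  exact: coord_continuous.
exact: (cvgM (cvg_cst (w 0 i)) (cvgM vi_cvg vi_cvg)).
Qed.

Lemma LK_functional_continuous (R : realType) (n l : nat)
    (f : 'cV[R]_n -> 'cV[R]_n) (p : 'rV[R]_n) (q : 'I_l -> 'rV[R]_n) :
  continuous f ->
  continuous (LK_functional f (diag_mx p) (fun j => diag_mx (q j))).
Proof.
move=> f_cont.
have P_cont : continuous (fun X : 'Seg[R]_(n, l) => qform (diag_mx p) (blk X ord0)).
  move=> X; apply: (@continuous_comp _ _ _ (fun Y : 'Seg[R]_(n, l) => blk Y ord0)).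
    exact: blk_continuous.
  exact: qform_continuous.
have Q_cont j : continuous (fun X : 'Seg[R]_(n, l) =>
    qform (diag_mx (q j)) (f (blk X (lift ord0 j)))).
  move=> X; apply: (@continuous_comp _ _ _
    (fun Y : 'Seg[R]_(n, l) => f (blk Y (lift ord0 j)))).
    apply: (@continuous_comp _ _ _ (fun Y : 'Seg[R]_(n, l) => blk Y _)).
      exact: blk_continuous.
    exact: f_cont.
  exact: qform_continuous.
move=> X; apply: cvgD; [exact: nbhs_filter|exact: P_cont|].
apply: cvg_big => [||j _]; [exact: add_continuous|exact: nbhs_filter|].
exact: Q_cont.
Qed.

(** * The energy of the image under the nonlinearity *)

(** The rate at which the functional dissipates. It is measured on f(x) rather
    than on x, since |f_i(t)| has no lower bound proportional to |t|. *)
Definition image_energy (R : realType) (n l : nat) (fc : 'I_n -> R -> R)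
    (X : 'Seg[R]_(n, l)) : R :=
  \sum_j \sum_i fc i (blk X j i 0) ^+ 2.

Lemma image_energy_ge0 (R : realType) (n l : nat) (fc : 'I_n -> R -> R)
    (X : 'Seg[R]_(n, l)) : 0 <= image_energy fc X.
Proof. by rewrite !sumr_ge0 // => j _; rewrite sumr_ge0 // => i _; rewrite sqr_ge0. Qed.

Lemma le_image_energy (R : realType) (n l : nat) (fc : 'I_n -> R -> R)
    (X : 'Seg[R]_(n, l)) (j : 'I_l.+1) (i : 'I_n) :
  fc i (blk X j i 0) ^+ 2 <= image_energy fc X.
Proof.
rewrite /image_energy (bigD1 j) //= (bigD1 i) //= -addrA lerDl.
rewrite addr_ge0 ?sumr_ge0 // => [k _|k _]; first exact: sqr_ge0.
by rewrite sumr_ge0 // => m _; rewrite sqr_ge0.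
Qed.

Lemma image_energy_gt0 (R : realType) (n l : nat)
    (f : 'cV[R]_n -> 'cV[R]_n) (fc : 'I_n -> R -> R) (X : 'Seg[R]_(n, l)) :
  admissible f fc -> X != 0 -> 0 < image_energy fc X.
Proof.
case=> _ _ f_sign _ X_neq0.
rewrite lt_neqAle image_energy_ge0 andbT; apply: contra X_neq0 => /eqP W0.
apply/eqP/mxcolP => j; apply/colP => i.
have -> : submxcol (0 : 'Seg[R]_(n, l)) j i 0 = 0 by rewrite !mxE.
apply/eqP; rewrite -[_ == _]negbK; apply/negP => /(f_sign i) /lt0r_neq0.
rewrite mulf_eq0 negb_or => /andP[_]; rewrite -sqrf_eq0.
suff -> : fc i (blk X j i 0) ^+ 2 = 0 by rewrite eqxx.
by apply/le_anti; rewrite sqr_ge0 andbT W0 le_image_energy.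
Qed.

Lemma sqr_coercive (R : realType) (g : R -> R) :
    g t @[t --> -oo] --> -oo -> g t @[t --> +oo] --> +oo ->
  forall M, exists2 T, 0 < T & forall t, T <= `|t| -> M <= g t ^+ 2.
Proof.
move=> /cvgrNyPle g_ninfty /cvgryPge g_pinfty M.
have [a [_ ha]] := g_ninfty (- (1 + `|M|)).
have [b [_ hb]] := g_pinfty (1 + `|M|).
exists (1 + `|a| + `|b|) => [|t]; first by rewrite -addrA ltr_pwDl // addr_ge0.
have M_le : M <= `|M| := ler_norm M.
have M_ge0 : 0 <= `|M| := normr_ge0 M.
have a_ge : - `|a| <= a by rewrite lerNl -normrN ler_norm.
have a_ge0 : 0 <= `|a| := normr_ge0 a.
have b_ge0 : 0 <= `|b| := normr_ge0 b.
have b_le : b <= `|b| := ler_norm b.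
have [t_ge0|t_lt0] := leP 0 t.
  rewrite (ger0_norm t_ge0) => t_ge.
  have : 1 + `|M| <= g t by apply: hb; lra.
  by move=> g_ge; nra.
rewrite (ltr0_norm t_lt0) => t_le.
have : g t <= - (1 + `|M|) by apply: ha; lra.
by move=> g_le; nra.
Qed.

(** A column of large norm has a large entry, and the corresponding component of
    [fc] is large there. *)
Lemma image_energy_coercive (R : realType) (n l : nat) (fc : 'I_n -> R -> R) :
    (forall i, fc i t @[t --> -oo] --> -oo) ->
    (forall i, fc i t @[t --> +oo] --> +oo) ->
  forall M, exists2 r, 0 < r &
    forall X : 'Seg[R]_(n, l), r <= enorm X -> M <= image_energy fc X.
Proof.
move=> fc_ninfty fc_pinfty M.
have /choice[T hT] : forall i, exists T, 0 < T /\
    forall t, T <= `|t| -> M <= fc i t ^+ 2.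
  move=> i; have [T T_gt0 hT] := sqr_coercive (fc_ninfty i) (fc_pinfty i) M.
  by exists T.
pose T0 := 1 + \sum_i T i.
have T0_gt0 : 0 < T0.
  by rewrite ltr_pwDl // sumr_ge0 // => i _; rewrite ltW //; case: (hT i).
have T_le i : T i <= T0.
  rewrite /T0 (bigD1 i) //= addrCA lerDl addr_ge0 // sumr_ge0 // => j _.
  by rewrite ltW //; case: (hT j).
pose c : R := (l.+1 * n)%:R.
have c_ge0 : 0 <= c by rewrite ler0n.
(* If all entries are below T0, the squared norm is at most c T0^2, and
   c < (1 + c)^2. *)
exists ((1 + c) * T0) => [|X]; first by rewrite mulr_gt0 // ltr_pwDl.
have [/existsP[j /existsP[i big_entry]] _|small] :=
    boolP [exists j, [exists i, T0 <= `|blk X j i 0|]].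
  apply: le_trans (le_image_energy fc X j i).
  by have [_] := hT i; apply; apply: le_trans big_entry.
suff : enorm X ^+ 2 <= c * T0 ^+ 2.
  move=> enorm_small; have := enorm_ge0 X => e_ge0 e_ge.
  have h1 : ((1 + c) * T0) ^+ 2 <= enorm X ^+ 2.
    by rewrite ler_sqr ?nnegrE // mulr_ge0 ?ltW // ltr_pwDl.
  have h2 : 0 < T0 ^+ 2 by rewrite exprn_gt0.
  have h3 : 0 <= c * T0 ^+ 2 by rewrite mulr_ge0 // ltW.
  have h4 : 0 <= c * (c * T0 ^+ 2) by rewrite mulr_ge0.
  by exfalso; nra.
rewrite sqr_enorm_blk.
have -> : c * T0 ^+ 2 = \sum_(j < l.+1) \sum_(i < n) T0 ^+ 2.
  by rewrite !sumr_const !card_ord -mulrnA mulr_natl mulnC.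
apply: ler_sum => j _; apply: ler_sum => i _.
move: small; rewrite negb_exists => /forallP /(_ j).
rewrite negb_exists => /forallP /(_ i); rewrite -ltNge => /ltW small_entry.
by rewrite -real_normK ?num_real // ler_sqr ?nnegrE // ltW.
Qed.

(** * Bounds on diagonal Lyapunov-Krasovskii functionals *)

Lemma LK_functionalE (R : realType) (n l : nat) (f : 'cV[R]_n -> 'cV[R]_n)
    (fc : 'I_n -> R -> R) (p : 'rV[R]_n) (q : 'I_l -> 'rV[R]_n)
    (X : 'Seg[R]_(n, l)) :
    admissible f fc ->
  LK_functional f (diag_mx p) (fun j => diag_mx (q j)) X
    = \sum_i p 0 i * blk X ord0 i 0 ^+ 2
      + \sum_j \sum_i q j 0 i * fc i (blk X (lift ord0 j) i 0) ^+ 2.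
Proof.
case=> _ fE _ _; rewrite /LK_functional qform_diag; congr (_ + _).
apply: eq_bigr => j _; rewrite qform_diag.
by apply: eq_bigr => i _; rewrite fE.
Qed.

Lemma admissible_sqr_le (R : realType) (n : nat) (f : 'cV[R]_n -> 'cV[R]_n)
    (fc : 'I_n -> R -> R) (i : 'I_n) (t : R) :
  admissible f fc -> fc i t ^+ 2 <= t ^+ 2.
Proof.
case=> _ _ _ f_le.
by rewrite -[leLHS]real_normK ?num_real // -[leRHS]real_normK ?num_real // ler_sqr ?nnegrE.
Qed.

Lemma LK_functional_ge (R : realType) (n l : nat) (f : 'cV[R]_n -> 'cV[R]_n)
    (fc : 'I_n -> R -> R) (p : 'rV[R]_n) (q : 'I_l -> 'rV[R]_n) (eps : R)
    (X : 'Seg[R]_(n, l)) :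
    admissible f fc -> 0 <= eps ->
    (forall i, eps <= p 0 i) -> (forall j i, eps <= q j 0 i) ->
  eps * image_energy fc X
    <= LK_functional f (diag_mx p) (fun j => diag_mx (q j)) X.
Proof.
move=> f_adm eps_ge0 p_ge q_ge; rewrite (LK_functionalE _ _ _ f_adm).
rewrite /image_energy big_ord_recl mulrDr; apply: lerD.
  rewrite mulr_sumr; apply: ler_sum => i _.
  by rewrite ler_pM ?sqr_ge0 // (admissible_sqr_le _ _ f_adm).
rewrite mulr_sumr; apply: ler_sum => j _; rewrite mulr_sumr.
by apply: ler_sum => i _; rewrite ler_wpM2r ?sqr_ge0.
Qed.

Lemma LK_functional_le (R : realType) (n l : nat) (f : 'cV[R]_n -> 'cV[R]_n)
    (fc : 'I_n -> R -> R) (p : 'rV[R]_n) (q : 'I_l -> 'rV[R]_n) :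
    admissible f fc ->
    (forall i, 0 <= p 0 i) -> (forall j i, 0 <= q j 0 i) ->
  exists2 c, 0 <= c & forall X : 'Seg[R]_(n, l),
    LK_functional f (diag_mx p) (fun j => diag_mx (q j)) X <= c * enorm X ^+ 2.
Proof.
move=> f_adm p_ge0 q_ge0.
pose sp := \sum_i p 0 i; pose sq := \sum_j \sum_i q j 0 i.
have sp_ge0 : 0 <= sp by rewrite sumr_ge0.
have sq_ge0 : 0 <= sq by rewrite sumr_ge0 // => j _; rewrite sumr_ge0.
exists (sp + sq) => [|X]; first by rewrite addr_ge0.
rewrite (LK_functionalE _ _ _ f_adm) sqr_enorm_blk big_ord_recl mulrDr.
apply: lerD; rewrite mulr_sumr; apply: ler_sum => i _.
  rewrite ler_wpM2r ?sqr_ge0 // -[leLHS]addr0 lerD //.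
  by rewrite /sp (bigD1 i) //= lerDl sumr_ge0.
rewrite mulr_sumr; apply: ler_sum => k _.
rewrite ler_pM ?sqr_ge0 ?(admissible_sqr_le _ _ f_adm) //.
rewrite -[leLHS]add0r lerD // /sq (bigD1 i) //= (bigD1 k) //= -addrA lerDl.
by rewrite addr_ge0 ?sumr_ge0 // => j _; rewrite sumr_ge0.
Qed.

(** * The descent inequality *)

Lemma exists_pos_lower_bound (R : realType) (n : nat) (w : 'I_n -> R) :
  (forall i, 0 < w i) -> exists2 m, 0 < m & forall i, m <= w i.
Proof.
move=> w_gt0; exists (\big[Order.min/1]_i w i) => [|i].
  by apply: lt_bigmin.
exact: bigmin_le_cond.
Qed.

(** The subsystem and the time index of the input are unrelated to those of
    other steps, so the inequality applies unchanged under any switching. The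
    lower bounds on the weights by [eps] are what makes the functional dominate
    [eps * image_energy]. *)
Lemma exists_LK_descent (R : realType) (n N l : nat)
    (A B : 'I_N -> 'M[R]_n) (f : 'cV[R]_n -> 'cV[R]_n) (fc : 'I_n -> R -> R)
    (u : nat -> 'cV[R]_n) (mu lambda : R) (d theta : 'cV[R]_n) :
    (forall s, nonneg_mx (A s)) -> (forall s, nonneg_mx (B s)) ->
    admissible f fc -> bounded_input u ->
    0 < mu -> 0 < lambda -> vpos d -> vpos theta ->
    (forall s r, vle ((A s + B r)^T *m d) (mu *: d)) ->
    (forall s, vle ((A s + B s) *m theta) (lambda *: theta)) ->
    lambda * mu < 1 ->
  exists (p : 'rV[R]_n) (q : 'I_l -> 'rV[R]_n) (eps C : R),
    let V := LK_functional f (diag_mx p) (fun j => diag_mx (q j)) in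
    [/\ 0 < eps, 0 <= C, forall i, eps <= p 0 i, forall j i, eps <= q j 0 i
      & forall (s : 'I_N) (x : int -> 'cV[R]_n) (k : int) (m : nat),
          x (k + 1) = A s *m f (x k) + B s *m f (x (k - l%:Z)) + u m ->
          V (segment l x (k + 1))
            <= V (segment l x k) + C - eps * image_energy fc (segment l x k)].
Proof.
move=> A_ge0 B_ge0 f_adm [M u_le] mu_gt0 lambda_gt0 d_gt0 th_gt0 hd hth hlm.
(* Any eta > 0 with (1 + eta) rho < 1 would do. *)
pose rho : R := lambda * mu; pose eta : R := (1 - rho) / 2; pose kap : R := 1 + eta.
have rho_gt0 : 0 < rho by rewrite mulr_gt0.
have eta_gt0 : 0 < eta by rewrite divr_gt0 ?subr_gt0.
have kap_gt0 : 0 < kap by rewrite addr_gt0.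
have gap_gt0 : 0 < 1 - kap * rho.
  have -> : 1 - kap * rho = (1 - rho) * (1 - rho / 2) by rewrite /kap /eta; field.
  by rewrite mulr_gt0 ?subr_gt0 // ltr_pdivrMr //; rewrite /rho; lra.
have p_gt0 i : 0 < d i 0 / theta i 0 by rewrite divr_gt0.
have [pm pm_gt0 pm_le] := exists_pos_lower_bound p_gt0.
(* The current state pays eps once for each of the l + 1 blocks of a segment. *)
pose eps : R := (1 - kap * rho) * pm / l.+1%:R.
have eps_gt0 : 0 < eps by rewrite divr_gt0 ?mulr_gt0.
have eps_l i : eps * l.+1%:R <= (1 - kap * rho) * (d i 0 / theta i 0).
  by rewrite /eps divfK ?pnatr_eq0 // ler_wpM2l // ltW.
pose beta i : R := \big[Order.max/0]_r ((B r)^T *m d) i 0.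
have BT_ge0 r i : 0 <= ((B r)^T *m d) i 0.
  rewrite mxE sumr_ge0 // => j _; rewrite mxE mulr_ge0 ?B_ge0 //.
  exact/ltW/d_gt0.
have beta_ge0 i : 0 <= beta i by apply: bigmax_ge_id.
have le_beta r i : ((B r)^T *m d) i 0 <= beta i 
  by exact: (le_bigmax _ (fun r0 => ((B r0)^T *m d) i 0)).
have A_beta s i : ((A s)^T *m d) i 0 + beta i <= mu * d i 0.
  have ABr r : ((A s)^T *m d) i 0 + ((B r)^T *m d) i 0 <= mu * d i 0.
    by have := hd s r i; rewrite linearD mulmxDl !mxE.
  rewrite -lerBrDl; apply: bigmax_le => [|r _]; last by rewrite lerBrDl.
  by rewrite subr_ge0 (le_trans _ (ABr s)) // lerDl.
pose b i := kap * lambda * (beta i / theta i 0).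
have b_ge0 i : 0 <= b i.
  by rewrite !mulr_ge0 ?invr_ge0 ?(ltW kap_gt0) ?(ltW lambda_gt0) ?(ltW (th_gt0 i)).
pose p : 'rV[R]_n := \row_i (d i 0 / theta i 0).
(* The index j stands for the delay j + 1, so the last weight is b + eps. *)
pose q (j : 'I_l) : 'rV[R]_n := \row_i (b i + eps * (l - j)%:R).
have M_ge0 : 0 <= M by apply: le_trans (u_le 0%N); exact: enorm_ge0.
pose sp := \sum_i d i 0 / theta i 0.
have sp_ge0 : 0 <= sp by rewrite sumr_ge0 // => i _; exact/ltW/p_gt0.
have inv_eta_ge0 : 0 <= 1 + eta^-1 by rewrite addr_ge0 // invr_ge0 ltW.
exists p, q, eps, ((1 + eta^-1) * (sp * M ^+ 2)); split=> //.
- by rewrite !mulr_ge0 ?sqr_ge0.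
- move=> i; rewrite mxE.
  have l_ge1 : 1 <= l.+1%:R :> R by rewrite ler1n.
  have kr_gt0 : 0 < kap * rho by rewrite mulr_gt0.
  have := eps_l i; have := p_gt0 i; nra.
- move=> j i; rewrite mxE -[leLHS]add0r lerD // ler_peMr ?(ltW eps_gt0) //.
  by rewrite ler1n subn_gt0.
move=> s x k m x_next.
pose G i (j : nat) := fc i (x (k - j%:Z) i 0) ^+ 2.
have [_ fE _ _] := f_adm.
rewrite !(LK_functionalE _ _ _ f_adm) /image_energy.
have -> : \sum_i p 0 i * blk (segment l x (k + 1)) ord0 i 0 ^+ 2
    = \sum_i d i 0 / theta i 0 * x (k + 1) i 0 ^+ 2.
  by apply: eq_bigr => i _; rewrite blk_segment subr0 mxE.
have -> : \sum_i p 0 i * blk (segment l x k) ord0 i 0 ^+ 2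
    = \sum_i d i 0 / theta i 0 * x k i 0 ^+ 2.
  by apply: eq_bigr => i _; rewrite blk_segment subr0 mxE.
have -> : \sum_j \sum_i q j 0 i * fc i (blk (segment l x (k + 1)) (lift ord0 j) i 0) ^+ 2
    = \sum_i \sum_(j < l) (b i + eps * (l - j)%:R) * G i j.
  rewrite exchange_big; apply: eq_bigr => i _; apply: eq_bigr => j _.
  have time_shift : k + 1 - (j : nat).+1%:Z = k - (j : nat)%:Z.
    by rewrite -addn1 PoszD; ring.
  by rewrite blk_segment mxE /G /= /bump /= add1n time_shift.
have -> : \sum_j \sum_i q j 0 i * fc i (blk (segment l x k) (lift ord0 j) i 0) ^+ 2
    = \sum_i \sum_(j < l) (b i + eps * (l - j)%:R) * G i j.+1.
  rewrite exchange_big; apply: eq_bigr => i _; apply: eq_bigr => j _.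
  by rewrite blk_segment mxE /G /= /bump /= add1n.
have -> : \sum_j \sum_i fc i (blk (segment l x k) j i 0) ^+ 2
    = \sum_i \sum_(j < l.+1) G i j.
  rewrite exchange_big; apply: eq_bigr => i _; apply: eq_bigr => j _.
  by rewrite blk_segment.
have energy := @forced_energy_le R n (A s) (B s) d theta (f (x k))
  (f (x (k - l%:Z))) (u m) lambda eta (A_ge0 s) (B_ge0 s) d_gt0 th_gt0
  lambda_gt0 eta_gt0 (hth s).
rewrite -x_next in energy.
have input_le : (1 + eta^-1) * \sum_i d i 0 / theta i 0 * u m i 0 ^+ 2
    <= (1 + eta^-1) * (sp * M ^+ 2).
  rewrite ler_wpM2l //; apply: (@le_trans _ _ (sp * enorm (u m) ^+ 2)).
    rewrite sqr_enorm mulr_sumr; apply: ler_sum => i _.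
    rewrite ler_wpM2r ?sqr_ge0 // /sp (bigD1 i) //= lerDl sumr_ge0 // => j _.
    exact/ltW/p_gt0.
  by rewrite ler_wpM2l // ler_sqr ?nnegrE ?enorm_ge0.
(* The sums over the delays decouple coordinate by coordinate. *)
have entrywise i :
    kap * lambda * (((A s)^T *m d) i 0 / theta i 0 * f (x k) i 0 ^+ 2
                  + ((B s)^T *m d) i 0 / theta i 0 * f (x (k - l%:Z)) i 0 ^+ 2)
    + \sum_(j < l) (b i + eps * (l - j)%:R) * (G i j - G i j.+1)
    <= d i 0 / theta i 0 * x k i 0 ^+ 2 - eps * \sum_(j < l.+1) G i j.
  rewrite delay_weights_sum.
  have -> : f (x k) i 0 ^+ 2 = G i 0%N by rewrite fE /G subr0.
  have -> : f (x (k - l%:Z)) i 0 ^+ 2 = G i l by rewrite fE.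
  have kl_gt0 : 0 < kap * lambda by rewrite mulr_gt0.
  have Gl_le : kap * lambda * (((B s)^T *m d) i 0 / theta i 0) * G i l <= b i * G i l.
    rewrite ler_wpM2r ?sqr_ge0 // /b ler_pM2l // ler_wpM2r ?le_beta //.
    by rewrite invr_ge0 ltW.
  have G0_coef : kap * lambda * (((A s)^T *m d) i 0 / theta i 0) + b i
      + eps * l.+1%:R <= d i 0 / theta i 0.
    have : kap * lambda * ((((A s)^T *m d) i 0 + beta i) / theta i 0)
        <= kap * lambda * (mu * d i 0 / theta i 0).
      by rewrite ler_pM2l // ler_wpM2r ?A_beta // invr_ge0 ltW.
    by have := eps_l i; rewrite /b /rho; lra.
  have G0_le : G i 0%N <= x k i 0 ^+ 2.
    by rewrite /G subr0 (admissible_sqr_le _ _ f_adm).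
  have G0_ge0 : 0 <= G i 0%N by rewrite sqr_ge0.
  have : d i 0 / theta i 0 * G i 0%N <= d i 0 / theta i 0 * x k i 0 ^+ 2.
    by rewrite ler_wpM2l // ltW.
  have := ler_wpM2r G0_ge0 G0_coef.
  lra.
have total := ler_sum (index_enum 'I_n) (fun i (_ : true) => entrywise i).
rewrite big_split /= -mulr_sumr sumrB -mulr_sumr in total.
have shift : \sum_i \sum_(j < l) (b i + eps * (l - j)%:R) * (G i j - G i j.+1)
   = \sum_i \sum_(j < l) (b i + eps * (l - j)%:R) * G i j
     - \sum_i \sum_(j < l) (b i + eps * (l - j)%:R) * G i j.+1.
  rewrite -sumrB; apply: eq_bigr => i _; rewrite -sumrB.
  by apply: eq_bigr => j _; rewrite mulrBr.
rewrite shift in total.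
rewrite -/kap in energy.
lra.
Qed.

(** * The theorem *)

Theorem theorem6p4 (R : realType) (n N l : nat)
  (n_gt0 : (0 < n)%N) (N_gt0 : (0 < N)%N) (l_gt0 : (0 < l)%N)
  (A B : 'I_N -> 'M[R]_n)
  (A_ge0 : forall s, nonneg_mx (A s)) (B_ge0 : forall s, nonneg_mx (B s))
  (f : 'cV[R]_n -> 'cV[R]_n) (fc : 'I_n -> R -> R)
  (f_adm : admissible f fc)
  (u : nat -> 'cV[R]_n) (u_bnd : bounded_input u)
  (fc_ninfty : forall i, fc i t @[t --> -oo] --> -oo)
  (fc_pinfty : forall i, fc i t @[t --> +oo] --> +oo)
  (mu lambda : R) (d theta : 'cV[R]_n)
  (mu_gt0 : 0 < mu) (lambda_gt0 : 0 < lambda)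
  (d_gt0 : vpos d) (theta_gt0 : vpos theta)
  (hd : forall s r, vle ((A s + B r)^T *m d) (mu *: d))
  (htheta : forall s, vle ((A s + B s) *m theta) (lambda *: theta))
  (hlm : lambda * mu < 1) :
  exists (P : 'M[R]_n) (Q : 'I_l -> 'M[R]_n),
    [/\ posdef_diag_mx P,
        forall j, posdef_diag_mx (Q j),
        common_LK_functional A B f u (LK_functional f P Q)
      & exists2 Rb : R, 0 < Rb & uniformly_ultimately_bounded l A B f u Rb].
Proof.
have [p [q [eps [C]]]] := exists_LK_descent l A_ge0 B_ge0 f_adm u_bnd mu_gt0
  lambda_gt0 d_gt0 theta_gt0 hd htheta hlm.
set V := LK_functional f _ _ => -[eps_gt0 C_ge0 p_ge q_ge descent].
have p_gt0 i : 0 < p 0 i := lt_le_trans eps_gt0 (p_ge i).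
have q_gt0 j i : 0 < q j 0 i := lt_le_trans eps_gt0 (q_ge j i).
have V_ge X : eps * image_energy fc X <= V X.
  exact: LK_functional_ge f_adm (ltW eps_gt0) p_ge q_ge.
have [c c_ge0 V_le] : exists2 c, 0 <= c & forall X, V X <= c * enorm X ^+ 2.
  exact: LK_functional_le f_adm (fun i => ltW (p_gt0 i))
    (fun j i => ltW (q_gt0 j i)).
have [r r_gt0 r_energy] := image_energy_coercive l fc_ninfty fc_pinfty ((C + 1) / eps).
have V_dec s (x : int -> 'cV[R]_n) k m :
    x (k + 1) = A s *m f (x k) + B s *m f (x (k - l%:Z)) + u m ->
    r <= enorm (segment l x k) -> V (segment l x (k + 1)) <= V (segment l x k) - 1.
  move=> /descent x_descent /r_energy; rewrite ler_pdivrMr // => W_ge.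
  by move: x_descent; lra.
exists (diag_mx p), (fun j => diag_mx (q j)); rewrite -/V; split.
- exact: diag_mx_posdef.
- by move=> j; exact: diag_mx_posdef.
- split.
  + by case: f_adm => f_cont _ _ _; exact: LK_functional_continuous.
  + split=> [|X X_neq0].
      have enorm0 : enorm (0 : 'Seg[R]_(n, l)) = 0.
        by rewrite /enorm big1 ?sqrtr0 // => i _; rewrite mxE expr0n.
      apply/le_anti; have := V_le 0; rewrite enorm0 expr0n mulr0 => -> /=.
      by apply: le_trans (V_ge 0); rewrite mulr_ge0 ?image_energy_ge0 // ltW.
    apply: lt_le_trans (V_ge X).
    by rewrite mulr_gt0 // (image_energy_gt0 f_adm).
  + move=> M; have [rM _ rM_energy] :=
      image_energy_coercive l fc_ninfty fc_pinfty (M / eps).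
    exists rM => X /rM_energy; rewrite ler_pdivrMr // mulrC => W_ge.
    exact: le_trans (V_ge X).
  + exists r, 1; split=> // s k0 x x_sol k k0k r_le.
    by have := V_dec _ _ _ _ (x_sol k k0k) r_le; lra.
(* V <= S on the ball of radius r, so V > S forces the segment outside it. *)
pose S := c * r ^+ 2.
have S_ge0 : 0 <= S by rewrite mulr_ge0 ?sqr_ge0.
(* The + 1 makes the bound strict: V <= S + C then excludes norms >= Rb. *)
have [Rb Rb_gt0 Rb_energy] :=
  image_energy_coercive l fc_ninfty fc_pinfty ((S + C + 1) / eps).
exists Rb => // D D_gt0.
(* V starts below c D^2 and loses 1 per step, hence this many steps suffice. *)
pose m := Num.bound (c * D ^+ 2).
have m_gt : c * D ^+ 2 < m%:R.
  by rewrite archi_boundP // mulr_ge0 ?sqr_ge0.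
exists m.+1 => // sigma k0 x x_sol x_init k k_ge.
pose v (i : nat) := V (segment l x (k0 + i)%N%:Z).
have x_next i : x ((k0 + i)%N%:Z + 1) = A (sigma (k0 + i)%N) *m f (x (k0 + i)%N%:Z)
    + B (sigma (k0 + i)%N) *m f (x ((k0 + i)%N%:Z - l%:Z)) + u (k0 + i)%N.
  by apply: x_sol; rewrite leq_addr.
have vS i : v i.+1 = V (segment l x ((k0 + i)%N%:Z + 1)).
  by rewrite /v addnS -addn1 PoszD.
have v_step i : v i.+1 <= v i + C.
  rewrite vS; apply: (le_trans (descent _ _ _ _ (x_next i))).
  by rewrite gerBl mulr_ge0 ?image_energy_ge0 // ltW.
have v_dec i : S < v i -> v i.+1 <= v i - 1.
  move=> v_gt; rewrite vS; apply: (V_dec _ _ _ _ (x_next i)).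
  rewrite leNgt; apply/negP => enorm_lt; move: v_gt; apply/negP; rewrite -leNgt.
  apply: le_trans (V_le _) _; rewrite ler_wpM2l // ler_sqr ?nnegrE ?enorm_ge0 ?ltW //.
have v_init : v 0%N <= S + m%:R.
  rewrite /v addn0 (le_trans (V_le _)) // (@le_trans _ _ (c * D ^+ 2)) //.
    by rewrite ler_wpM2l // ler_sqr ?nnegrE ?enorm_ge0 // ltW.
  by rewrite -[leLHS]add0r lerD // ltW.
have := @eventually_trapped R v S C m C_ge0 v_step v_dec v_init (k - k0)%N.
have k0k : (k0 <= k)%N by apply: leq_trans k_ge; rewrite leq_addl.
rewrite /v subnKC // => V_small.
have {}V_small : V (segment l x k%:Z) <= S + C.
  by apply: V_small; rewrite leq_subRL // addnC ltnW // -addSn.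
have seg_lt : enorm (segment l x k%:Z) <= Rb.
  rewrite leNgt; apply/negP => /ltW /Rb_energy; rewrite ler_pdivrMr // mulrC.
  by have := V_ge (segment l x k%:Z); lra.
apply: le_trans seg_lt; apply: enorm_le.
rewrite sqr_enorm_blk big_ord_recl blk_segment subr0 -sqr_enorm lerDl.
by rewrite sumr_ge0 // => j _; rewrite sumr_ge0 // => i _; rewrite sqr_ge0.
Qed.
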